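(* Let $R$ be a finite commutative local ring which is not a field. Then $\Gamma(\mathbb{Z}_2\times R)$ is partitionable into global defensive alliances if and only if $R\cong \mathbb{Z}_4$ or $R\cong \mathbb{Z}_2[X]/(X^2)$. Moreover, if $\Gamma(\mathbb{Z}_2\times R)$ is partitionable into global defensive alliances, then $\psi_g(\Gamma(\mathbb{Z}_2\times R))=2$.
   Context: Rings are commutative with $1\neq 0$, and $\mathbb{Z}_n=\mathbb{Z}/n\mathbb{Z}$. For a commutative ring $R$ with $1\neq 0$, the zero-divisor graph $\Gamma(R)$ is the simple graph whose vertices are the nonzero zero-divisors of $R$, two distinct vertices $x,y$ being adjacent if and only if $xy=0$. Let $\Gamma=(V,E)$ be a finite simple graph. For $S\subseteq V$ put $\bar S=V\setminus S$ and $\deg_S(x)=|S\cap N(x)|$, where $N(x)$ is the set of vertices adjacent to $x$. A nonempty $S\subseteq V$ is a dominating set if $\deg_S(v)>0$ for every $v\in\bar S$; it is a defensive alliance if $\deg_S(x)+1\ge \deg_{\bar S}(x)$ for every $x\in S$; it is a global defensive alliance if it is both. The global defensive alliance partition number $\psi_g(\Gamma)$ is the maximum number of sets in a partition of $V$ such that each set is a global defensive alliance; $\Gamma$ is partitionable into global defensive alliances if $\psi_g(\Gamma)\ge 2$. *)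

(* Defs.v *)
From HB Require Import structures.
From mathcomp Require Import all_boot all_order all_algebra.

Set Implicit Arguments.
Unset Strict Implicit.
Unset Printing Implicit Defensive.

Import GRing.Theory.
Local Open Scope ring_scope.

(* MathComp equips R * S separately with its finite-type and its ring
   structures, but does not declare their join. *)
HB.instance Definition _ (R S : finComNzRingType) :=
  Finite.on (R * S)%type.

Record sgraph := SGraph {
  vertex :> finType;
  adj : rel vertex;
  adj_sym : symmetric adj;
  adj_irrefl : irreflexive adj
}.

Section Alliances.
Variable G : sgraph.
Implicit Types (S : {set G}) (P : {set {set G}}) (x : G).

Definition nbhd x : {set G} := [set y | adj x y].

Definition deg_in S x : nat := #|S :&: nbhd x|.

Definition dominating S : bool :=
  (S != set0) && [forall v in ~: S, (0 < deg_in S v)%N].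

Definition defensive_alliance S : bool :=
  (S != set0) && [forall x in S, (deg_in (~: S) x <= deg_in S x + 1)%N].

Definition global_defensive_alliance S : bool :=
  dominating S && defensive_alliance S.

Definition gda_partition P : bool :=
  partition P [set: G] && [forall S in P, global_defensive_alliance S].

Definition psi_g : nat := (\max_(P : {set {set G}} | gda_partition P) #|P|)%N.

Definition gda_partitionable : Prop := (2 <= psi_g)%N.

End Alliances.

Section ZeroDivisorGraph.
Variable R : finComNzRingType.

Definition nonzero_zero_divisor (x : R) : bool :=
  (x != 0) && [exists y : R, (y != 0) && (x * y == 0)].

Definition zdvertex : finType := {x : R | nonzero_zero_divisor x}.

Definition zdadj : rel zdvertex :=
  fun x y => (x != y) && (val x * val y == 0).

Lemma zdadj_sym : symmetric zdadj.
Proof. by move=> x y; rewrite /zdadj eq_sym mulrC. Qed.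

Lemma zdadj_irrefl : irreflexive zdadj.
Proof. by move=> x; rewrite /zdadj eqxx. Qed.

Definition zero_divisor_graph : sgraph := SGraph zdadj_sym zdadj_irrefl.

End ZeroDivisorGraph.

(* [idealr_closed] describes the proper ideals. *)
Definition maximal_ideal (R : finComNzRingType) (M : {set R}) : Prop :=
  idealr_closed (mem M) /\
  forall I : {set R}, idealr_closed (mem I) -> M \subset I -> I = M.

Definition local_ring (R : finComNzRingType) : Prop :=
  exists! M : {set R}, maximal_ideal M.

(* [GRing.field_axiom] for a ring without a chosen inverse operation. *)
Definition is_field (R : comNzRingType) : Prop :=
  forall x : R, x != 0 -> exists y : R, x * y = 1.

Definition ring_isomorphic (R S : nzRingType) : Prop :=
  exists f : {rmorphism R -> S}, bijective f.

(* Main.v *)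
From HB Require Import structures.
Require Import Defs.
From mathcomp Require Import all_boot all_order all_algebra.
From mathcomp Require Import zify.

(** Every unit u of R gives a leaf (0, u) of the graph, attached to the hub
    (1, 0). Hence a block T avoiding the hub contains all the leaves, so there
    are at most two blocks. The alliance condition for the block S of the hub
    forces half of R to be non-invertible and S to contain every (0, r) with r
    a nonzero non-unit. Then T dominates (0, r) through some (1, b) with
    b r = 0, and the alliance condition at (1, b) gives Ann(b) = {0, r}.
    Locality makes r annihilate the maximal ideal, so the maximal ideal is
    {0, r}, with r r = 0, and R has 4 elements. There are two such rings,
    according to whether 2 = 0; conversely {(1, 0), (0, r)} and its complement
    are global defensive alliances. *)

Set Implicit Arguments.
Unset Strict Implicit.
Unset Printing Implicit Defensive.

Import GRing.Theory.
Local Open Scope ring_scope.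

(** * Alliance partitions of a graph and the effect of a leaf *)

Section AlliancePartitions.
Variable G : sgraph.
Implicit Types (S T : {set G}) (P : {set {set G}}) (x y : G).

Lemma deg_in_gt0 S x y : y \in S -> adj x y -> (0 < deg_in S x)%N.
Proof. by move=> yS xy; apply/card_gt0P; exists y; rewrite !inE yS. Qed.

Lemma deg_in_le S T x :
  {in S, forall y, adj x y -> y \in T} -> (deg_in S x <= #|T|)%N.
Proof.
move=> ST; apply/subset_leq_card/subsetP=> y.
by rewrite !inE => /andP[/ST].
Qed.

Lemma gda_partitionableP :
  gda_partitionable G <->
  exists2 P : {set {set G}}, gda_partition P & (1 < #|P|)%N.
Proof.
split=> [|[P gP cP]]; last first.
  by rewrite /gda_partitionable /psi_g (leq_trans cP) // leq_bigmax_cond.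
rewrite /gda_partitionable /psi_g => psi2.
have [/existsP[P /andP[gP cP]]|noP] :=
  boolP [exists P : {set {set G}}, gda_partition P && (1 < #|P|)%N].
  by exists P.
suff: (psi_g G <= 1)%N by rewrite leqNgt psi2.
apply/bigmax_leqP => P gP; rewrite leqNgt.
by apply: contraNN noP => cP; apply/existsP; exists P; rewrite gP.
Qed.

Lemma dominating_leaf S x y :
  dominating S -> (forall z, adj y z -> z = x) -> x \notin S -> y \in S.
Proof.
case/andP=> _ /forall_inP dS leaf xS; apply: contraNT xS => yS.
have /card_gt0P[z] := dS y (etrans (in_setC _ _) yS).
by rewrite !inE => /andP[zS /leaf <-].
Qed.

(** By [dominating_leaf] each block contains the leaf [y] or its neighbour [x], so it is one of the
    blocks of these two vertices. *)
Lemma leaf_psi_g x y : (forall z, adj y z -> z = x) -> (psi_g G <= 2)%N.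
Proof.
move=> leaf; apply/bigmax_leqP => P /andP[partP /forall_inP gP].
have /and3P[/eqP cP tP _] := partP.
have: P \subset [set pblock P x; pblock P y].
  apply/subsetP=> B BP; have /andP[dB _] := gP _ BP.
  have [xB|xB] := boolP (x \in B).
    by rewrite !inE (def_pblock tP BP xB) eqxx.
  have yB := dominating_leaf dB leaf xB.
  by rewrite !inE (def_pblock tP BP yB) eqxx orbT.
by move/subset_leq_card/leq_trans; apply; rewrite cards2; case: (_ != _).
Qed.

(** This is all that the forward implication takes from a partition: the block of [x] and a second
    block. It is applied with [x] the hub. *)
Lemma gda_partitionable_blocks x : gda_partitionable G ->
  exists S T : {set G}, [/\ global_defensive_alliance S,
    global_defensive_alliance T, [disjoint S & T] & x \in S].
Proof.
case/gda_partitionableP=> P /andP[/and3P[/eqP cP tP _] /forall_inP gP] cardP.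
have xP : x \in cover P by rewrite cP.
have SP := pblock_mem xP.
have [T] : exists T, T \in P :\ pblock P x.
  by apply/card_gt0P; move: cardP; rewrite (cardsD1 (pblock P x) P) SP.
rewrite !inE => /andP[TS TP]; exists (pblock P x), T; split; rewrite ?gP //.
  by move/trivIsetP: tP; apply=> //; rewrite eq_sym.
by rewrite mem_pblock.
Qed.

Lemma gda_bipartition_partitionable S :
  global_defensive_alliance S -> global_defensive_alliance (~: S) ->
  gda_partitionable G.
Proof.
move=> gS gT; apply/gda_partitionableP.
have S0 : S != set0 by case/andP: gS => /andP[].
have T0 : ~: S != set0 by case/andP: gT => /andP[].
have ST : S != ~: S.
  apply: contra_neqN S0 => /eqP eST; apply/setP=> x; rewrite inE.
  by apply/negP=> xS; move: (xS); rewrite eST inE xS.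
exists [set S; ~: S]; last by rewrite cards2 ST.
apply/andP; split; last by apply/forall_inP=> B /set2P[]->.
apply/and3P; split; last by rewrite !inE negb_or eq_sym S0 eq_sym T0.
  by rewrite /cover bigcup_setU !big_set1 setUCr.
apply/trivIsetP=> B C /set2P[]-> /set2P[]-> //; rewrite ?eqxx // => _.
  by rewrite disjoints_subset setCK.
by rewrite disjoints_subset.
Qed.

End AlliancePartitions.

(** * Units, zero-divisors and locality in finite rings *)

Section FiniteRings.
Variable R : finComNzRingType.
Implicit Types x y : R.

(** Boolean, so that the non-units form a finite set that can be counted. *)
Definition invertible x := [exists y : R, x * y == 1].

Lemma invertible0 : ~~ invertible 0.
Proof. by apply/existsPn=> y; rewrite mul0r eq_sym oner_eq0. Qed.

Lemma invertible1 : invertible 1.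
Proof. by apply/existsP; exists 1; rewrite mulr1. Qed.

Lemma cardsD_zero (A : {set R}) : 0 \in A -> #|A| = #|A :\ 0|.+1.
Proof. by move=> A0; rewrite (cardsD1 0) A0. Qed.

Lemma invertible_mul_eq0 x y : invertible x -> x * y = 0 -> y = 0.
Proof.
by case/existsP=> z /eqP xz xy; rewrite -[y]mul1r -xz mulrAC xy mul0r.
Qed.

Lemma zero_divisor_noninvertible x y :
  y != 0 -> x * y = 0 -> ~~ invertible x.
Proof.
move=> y0 xy; apply: contraNN y0 => ux.
by rewrite (invertible_mul_eq0 ux xy).
Qed.

(** An injective self-map of a finite set is onto; multiplication by a non-unit misses 1, so it
    identifies two elements, and [x] kills their difference. *)
Lemma noninvertible_zero_divisor x :
  ~~ invertible x -> exists2 y, y != 0 & x * y = 0.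
Proof.
move=> nx; have /injectivePn[y [z yz xyz]] : ~~ injectiveb ( *%R x).
  apply: contraNN nx => /injectiveP injx; apply/existsP.
  by exists (invF injx 1); rewrite f_invF.
by exists (y - z); rewrite ?subr_eq0 // mulrBr xyz subrr.
Qed.

(** Boolean form of [idealr_closed], as required to extract a maximal set with [maxset_exists]. *)
Definition idealb (I : {set R}) :=
  [&& 0 \in I, 1 \notin I &
     [forall a, forall u in I, forall v in I, a * u + v \in I]].

Lemma idealP (I : {set R}) : reflect (idealr_closed (mem I)) (idealb I).
Proof.
apply: (iffP and3P) => -[I0 I1 cI]; split=> //.
  by move=> a u v uI vI; apply: (forall_inP (forall_inP (forallP cI a) u uI)).
by apply/forallP=> a; apply/forall_inP=> u uI; apply/forall_inP=> v; apply: cI.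
Qed.

Lemma noninvertible_maximal_ideal x :
  ~~ invertible x -> exists2 M, maximal_ideal M & x \in M.
Proof.
move=> nx; have iI : idealb [set x * y | y : R].
  apply/idealP; split; rewrite ?inE.
  - by apply/imsetP; exists 0; rewrite ?mulr0.
  - apply: contraNN nx => /imsetP[y _ xy].
    by apply/existsP; exists y; rewrite -xy.
  - move=> a _ _ /imsetP[y _ ->] /imsetP[z _ ->]; apply/imsetP.
    by exists (a * y + z); rewrite // mulrDr mulrCA.
have [M /maxsetP[/idealP iM maxM] IM] := maxset_exists iI; exists M.
  by split=> // J /idealP iJ; apply: maxM.
by apply: (subsetP IM); apply/imsetP; exists 1; rewrite ?mulr1.
Qed.

(** Otherwise [x] and [1 - x] both lie in the unique maximal ideal, and so does their sum 1. *)
Lemma local_invertible1B x :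
  local_ring R -> ~~ invertible x -> invertible (1 - x).
Proof.
case=> M [[[_ M1 cM] _] uM] /noninvertible_maximal_ideal[_ /uM<- xM].
have [//|] := boolP (invertible (1 - x)).
move=> /noninvertible_maximal_ideal[_ /uM<- x1M].
by case/negP: M1; have := cM 1 _ _ x1M xM; rewrite mul1r subrK.
Qed.

(** The map sending x to 1 - x injects the non-units into the units. *)
Lemma local_noninvertible_card :
  local_ring R -> (2 * #|[set x | ~~ invertible x]| <= #|R|)%N.
Proof.
move=> locR; set N := [set x | _].
rewrite -(cardsC N) mul2n -addnn leq_add2l.
have inj1B : injective (fun x : R => 1 - x) by move=> x y /addrI/oppr_inj.
rewrite -(card_imset N inj1B) subset_leq_card //.
apply/subsetP=> _ /imsetP[x + ->]; rewrite !inE negbK.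
exact: local_invertible1B.
Qed.

End FiniteRings.

(** * Rings of order four with a nonzero element of square zero *)

Definition order4_nilpotent (R : finComNzRingType) :=
  #|R| = 4%N /\ exists2 m : R, m != 0 & m * m = 0.

Lemma Z2P (x : 'Z_2) : x = 0 \/ x = 1.
Proof. by case: x => -[|[|//]] i; [left | right]; apply: val_inj. Qed.

Lemma nilpotent_add1_neq0 (R : nzRingType) (m : R) : m * m = 0 -> 1 + m != 0.
Proof.
apply: contra_eq_neq => /eqP; rewrite addrC addr_eq0 => /eqP->.
by rewrite mulrNN mulr1 oner_eq0.
Qed.

(** The four listed elements are pairwise distinct, so they exhaust [R]. *)
Lemma order4_enum (R : finComNzRingType) (m x : R) :
  #|R| = 4%N -> m != 0 -> m * m = 0 -> [\/ x = 0, x = 1, x = m | x = 1 + m].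
Proof.
move=> R4 m0 mm; pose s : seq R := [:: 0; 1; m; 1 + m].
have m1 : m != 1 by apply: contra_eq_neq mm => ->; rewrite mulr1 oner_eq0.
have m1N := nilpotent_add1_neq0 mm.
have us : uniq s.
  rewrite /= !inE !negb_or eq_sym oner_eq0 eq_sym m0 eq_sym m1N eq_sym m1 /=.
  rewrite -{1}[1]addr0 (inj_eq (addrI _)) eq_sym m0 /=.
  by rewrite -{1}[m]add0r (inj_eq (addIr _)) eq_sym oner_eq0.
have sR : {subset s <= enum R} by move=> y _; rewrite mem_enum.
have szR : (size (enum R) <= size s)%N by rewrite -cardE R4.
have : x \in s by have [_ ->] := uniq_min_size us sR szR; rewrite mem_enum.
rewrite !inE => /or4P[]/eqP->.
- by constructor 1.
- by constructor 2.
- by constructor 3.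
- by constructor 4.
Qed.

Lemma ring_isomorphic_sym (R S : nzRingType) :
  ring_isomorphic R S -> ring_isomorphic S R.
Proof.
case=> f [g fK gK].
pose gz := GRing.isZmodMorphism.Build S R g (can2_zmod_morphism fK gK).
pose gm := GRing.isMonoidMorphism.Build S R g (can2_monoid_morphism fK gK).
pose g' : {rmorphism S -> R} := HB.pack g gz gm.
by exists g'; exists f.
Qed.

(** Translation by 1 permutes [R], so the sum of all elements is unchanged when [#|R|] copies of 1
    are added to it. *)
Lemma natr_card (R : finComNzRingType) : #|R|%:R = 0 :> R.
Proof.
have /addIr : #|R|%:R + \sum_(x : R) x = 0 + \sum_(x : R) x; last exact.
rewrite add0r [RHS](reindex_inj (addrI 1)) /= big_split /=.
by rewrite sumr_const cardT.
Qed.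

Section ZpMorphism.
Variables (R : nzRingType) (n : nat).
Hypotheses (n_gt1 : (1 < n)%N) (Rn : n%:R = 0 :> R).

Definition Zp_natmul (x : 'Z_n) : R := (x : nat)%:R.

Let natr_mod k : (k %% (Zp_trunc n).+2)%:R = k%:R :> R.
Proof.
(* The modulus of ['Z_n] is [(Zp_trunc n).+2], which equals [n] because [1 < n]. *)
by rewrite Zp_cast // {2}(divn_eq k n) natrD natrM Rn mulr0 add0r.
Qed.

Lemma Zp_natmul_zmod_morphism : zmod_morphism Zp_natmul.
Proof.
have natD (x y : 'Z_n) : Zp_natmul (x + y) = Zp_natmul x + Zp_natmul y.
  by rewrite /Zp_natmul natr_mod natrD.
by move=> x y; apply/eqP; rewrite eq_sym subr_eq -natD subrK.
Qed.

Lemma Zp_natmul_monoid_morphism : monoid_morphism Zp_natmul.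
Proof. by split=> [|x y]; rewrite /Zp_natmul natr_mod // natrM. Qed.

Definition Zp_rmorphism : {rmorphism 'Z_n -> R} :=
  HB.pack Zp_natmul
    (GRing.isZmodMorphism.Build _ _ _ Zp_natmul_zmod_morphism)
    (GRing.isMonoidMorphism.Build _ _ _ Zp_natmul_monoid_morphism).
End ZpMorphism.

Section OrderFour.
Variables (R : finComNzRingType) (m : R).
Hypotheses (R4 : #|R| = 4%N) (m0 : m != 0) (mm : m * m = 0).

Lemma order4_isoZ4 : 2%:R != 0 :> R -> ring_isomorphic R 'Z_4.
Proof.
move=> two0; apply: ring_isomorphic_sym.
have R40 : 4%:R = 0 :> R by rewrite -R4 natr_card.
exists (Zp_rmorphism (isT : (1 < 4)%N) R40).
apply: inj_card_bij; last by rewrite R4 card_ord.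
(* The kernel is trivial: 1 and 2 are nonzero in [R], and 3 = 0 together with 4 = 0 would give 1 =
   0. *)
apply: raddf_inj => x; rewrite /= /Zp_natmul.
case: x => -[|[|[|[|//]]]] i /= x0; apply/val_inj => //=.
- by move/eqP: x0; rewrite oner_eq0.
- by move/eqP: x0; rewrite (negPf two0).
- by move/eqP: R40; rewrite (natrD _ 3 1) x0 add0r oner_eq0.
Qed.

(** Evaluation at [m] factors through the quotient by X^2 because [m * m = 0]. It is defined on the
    reduced representative [val p]. *)
Lemma order4_isoX2 :
  2%:R = 0 :> R -> ring_isomorphic R {poly %/ ('X^2 : {poly 'Z_2})}.
Proof.
move=> two0; apply: ring_isomorphic_sym.
pose g := Zp_rmorphism (isT : (1 < 2)%N) two0.
pose ev : {rmorphism {poly 'Z_2} -> R} := horner_morph (fun x => mulrC m (g x)).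
pose f (p : {poly %/ ('X^2 : {poly 'Z_2})}) : R := ev (val p).
(* [mk_monic] is the modulus actually used by the quotient; it leaves the monic polynomial X^2
   unchanged. *)
have evX2 : ev (mk_monic 'X^2) = 0.
  by rewrite mk_monic_Xn rmorphXn [ev 'X]horner_morphX expr2.
have fZ : zmod_morphism f by move=> p q; exact: (rmorphB ev (val p) (val q)).
have fM : monoid_morphism f.
  split=> [|p q]; first by rewrite /f rmorph1.
  (* The product in the quotient is the remainder of the product of representatives; the discarded
     multiple of X^2 evaluates to 0. *)
  rewrite /f -rmorphM.
  rewrite (Pdiv.RingMonic.rdivp_eq (monic_mk_monic 'X^2) (val p * val q)).
  by rewrite rmorphD rmorphM evX2 mulr0 add0r.
pose F : {rmorphism _ -> R} := HB.pack f (GRing.isZmodMorphism.Build _ _ _ fZ)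
    (GRing.isMonoidMorphism.Build _ _ _ fM).
have sp (p : {poly %/ ('X^2 : {poly 'Z_2})}) : (size (val p) <= 2)%N.
  by rewrite -ltnS (leq_trans (size_mk_monic p)) // mk_monic_Xn size_polyXn.
have FE p : F p = g (val p)`_0 + g (val p)`_1 * m.
  have sgp : (size (map_poly g (val p)) <= 2)%N.
    exact: leq_trans (size_poly _ _) (sp p).
  rewrite -[LHS]/((map_poly g (val p)).[m]) (horner_coef_wide _ sgp).
  rewrite !big_ord_recl big_ord0.
  by rewrite !coef_map expr0 mulr1 expr1 addr0.
exists F; apply: inj_card_bij; last first.
  by rewrite R4 card_monic_qpoly ?monicXn ?size_polyXn // card_ord.
(* The two coefficients of [p] are 0 or 1, so the value is 0, [m], 1 or [1 + m], and only the first
   of these vanishes. *)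
apply: raddf_inj => p p0; have {p0} := etrans (esym (FE p)) p0.
case: (Z2P (val p)`_0) (Z2P (val p)`_1) => [p0|p0] [p1|p1].
all: rewrite p0 p1 ?rmorph0 ?rmorph1 ?add0r ?mul0r ?mul1r ?addr0 => /eqP.
- move=> _; apply/val_inj/polyP => -[|[|k]]; rewrite coef0 //.
  by rewrite nth_default // (leq_trans (sp p)).
- by rewrite (negPf m0).
- by rewrite oner_eq0.
- by rewrite (negPf (nilpotent_add1_neq0 mm)).
Qed.
End OrderFour.

(** The square-zero element is pulled back from the target: 2 in ['Z_4], the class of X in the
    quotient by X^2. *)
Lemma isomorphic_order4_nilpotent (R : finComNzRingType) :
  ring_isomorphic R 'Z_4 \/
    ring_isomorphic R {poly %/ ('X^2 : {poly 'Z_2})} ->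
  order4_nilpotent R.
Proof.
have sqr0 (S : nzRingType) (f : {rmorphism R -> S}) (y : S) :
    bijective f -> y != 0 -> y * y = 0 -> exists2 m : R, m != 0 & m * m = 0.
  move=> [g fK gK] y0 yy; exists (g y).
    by apply: contra_neq y0 => gy; rewrite -(gK y) gy rmorph0.
  by apply: (can_inj fK); rewrite rmorphM rmorph0 gK.
case=> -[f bf]; split.
- by rewrite (bij_eq_card bf) card_ord.
- by apply: (sqr0 _ _ (2%:R : 'Z_4) bf) => //; apply: val_inj.
- rewrite (bij_eq_card bf).
  by rewrite card_monic_qpoly ?monicXn ?size_polyXn // card_ord.
apply: (sqr0 _ _ (qpolyX 'X^2) bf).
  apply/eqP=> /(congr1 (@polyn _ _)).
  by rewrite qpolyXE ?size_polyXn ?monicXn // => /eqP; rewrite polyX_eq0.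
rewrite -in_qpolyM -expr2; apply: val_inj.
by rewrite /= mk_monic_Xn Pdiv.RingMonic.rmodpp ?monicXn.
Qed.

Lemma order4_nilpotent_isomorphic (R : finComNzRingType) :
  order4_nilpotent R ->
  ring_isomorphic R 'Z_4 \/ ring_isomorphic R {poly %/ ('X^2 : {poly 'Z_2})}.
Proof.
move=> [R4 [m m0 mm]].
have [two0|two0] := eqVneq (2%:R : R) 0; [right | left].
  exact: order4_isoX2 R4 m0 mm two0.
exact: order4_isoZ4.
Qed.

(** * The zero-divisor graph of the product of Z_2 and R *)

Section ZeroDivisorGraphZ2.
Variable R : finComNzRingType.
Local Notation G := (zero_divisor_graph ('Z_2 * R)%type).
Implicit Types (v w : G) (r s : R).

Lemma mul_pair (R1 R2 : pzRingType) (a c : R1) (b d : R2) :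
  (a, b) * (c, d) = (a * c, b * d) :> R1 * R2.
Proof. by []. Qed.

Lemma vertex01_subproof : nonzero_zero_divisor ((1, 0) : 'Z_2 * R).
Proof.
apply/andP; split; first by rewrite xpair_eqE oner_eq0.
apply/existsP; exists (0, 1); rewrite mul_pair !xpair_eqE oner_eq0.
by rewrite mulr0 mul0r !eqxx.
Qed.

Definition pair_of v : 'Z_2 * R := val v.

Lemma pair_of_inj : injective pair_of. Proof. exact: val_inj. Qed.

Definition hub : G := Sub ((1, 0) : 'Z_2 * R) vertex01_subproof.

(* Opaque, as unification would otherwise evaluate [nonzero_zero_divisor] by
   enumerating R. *)
Lemma vertex_of_pair :
  {f : 'Z_2 * R -> G | forall x, nonzero_zero_divisor x -> pair_of (f x) = x}.
Proof.
by exists (insubd hub) => x zx; rewrite /pair_of val_insubd ifT.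
Qed.

(** The pairs (0, 0) and (1, u) with u a unit are not vertices, so [vertex0] is meaningful only at
    nonzero elements and [vertex1] only at non-units; elsewhere the value is unspecified. *)
Definition vertex0 r : G := sval vertex_of_pair (0, r).
Definition vertex1 r : G := sval vertex_of_pair (1, r).

Lemma pair_of_vertex0 r : r != 0 -> pair_of (vertex0 r) = (0, r).
Proof.
move=> r0; apply: (svalP vertex_of_pair); apply/andP; split.
  by rewrite xpair_eqE negb_and r0 orbT.
apply/existsP; exists (1, 0); rewrite mul_pair !xpair_eqE oner_eq0.
by rewrite mulr0 mul0r !eqxx.
Qed.

Lemma pair_of_vertex1 r : ~~ invertible r -> pair_of (vertex1 r) = (1, r).
Proof.
move=> /noninvertible_zero_divisor[y y0 ry].
apply: (svalP vertex_of_pair); apply/andP; split.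
  by rewrite xpair_eqE oner_eq0.
apply/existsP; exists (0, y); rewrite mul_pair !xpair_eqE (negPf y0) andbF.
by rewrite mulr0 ry !eqxx.
Qed.

(** If (1, r) kills a nonzero (c, d), then c = 0, so d is nonzero with r d = 0, and r is not a
    unit. *)
Lemma vertexP v :
  (exists2 r, r != 0 & v = vertex0 r) \/
  (exists2 r, ~~ invertible r & v = vertex1 r).
Proof.
have /andP[v0 /existsP[[c d] /andP[cd0 /eqP vcd]]] :
  nonzero_zero_divisor (pair_of v) := valP v.
move: v0 vcd cd0; case Ev: (pair_of v) => [a r].
have [a0|a1] := Z2P a; subst a.
  rewrite !xpair_eqE eqxx /= => r0 _ _; left; exists r => //.
  by apply: pair_of_inj; rewrite pair_of_vertex0.
move=> _ /eqP; rewrite mul_pair mul1r xpair_eqE => /andP[/eqP-> /eqP rd].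
rewrite xpair_eqE eqxx /= => d0.
have nr : ~~ invertible r := zero_divisor_noninvertible d0 rd.
by right; exists r => //; apply: pair_of_inj; rewrite pair_of_vertex1.
Qed.

Lemma vertex1_0 : vertex1 0 = hub.
Proof. by apply: pair_of_inj; rewrite pair_of_vertex1 ?invertible0. Qed.

Let adjE v w :
  adj v w = (pair_of v != pair_of w) && (pair_of v * pair_of w == 0).
Proof. by []. Qed.

Lemma adj_vertex00 r s : r != 0 -> s != 0 ->
  adj (vertex0 r) (vertex0 s) = (r != s) && (r * s == 0).
Proof.
move=> r0 s0; rewrite adjE (pair_of_vertex0 r0) (pair_of_vertex0 s0).
by rewrite mul_pair !xpair_eqE mul0r eqxx.
Qed.

Lemma adj_vertex01 r s : r != 0 -> ~~ invertible s ->
  adj (vertex0 r) (vertex1 s) = (r * s == 0).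
Proof.
move=> r0 ns; rewrite adjE (pair_of_vertex0 r0) (pair_of_vertex1 ns).
by rewrite mul_pair !xpair_eqE mul0r eqxx.
Qed.

Lemma adj_vertex11 r s : ~~ invertible r -> ~~ invertible s ->
  adj (vertex1 r) (vertex1 s) = false.
Proof.
move=> nr ns; rewrite adjE (pair_of_vertex1 nr) (pair_of_vertex1 ns).
by rewrite mul_pair !xpair_eqE mulr1 oner_eq0 andbF.
Qed.

Lemma vertex0_inj : {in [pred r | r != 0] &, injective vertex0}.
Proof.
move=> r s r0 s0 /(congr1 pair_of).
by rewrite (pair_of_vertex0 r0) (pair_of_vertex0 s0) => -[].
Qed.

Lemma adj_vertex0_hub r : r != 0 -> adj (vertex0 r) hub.
Proof. by move=> r0; rewrite -vertex1_0 adj_vertex01 ?invertible0 ?mulr0. Qed.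

Lemma adj_hub v : adj hub v -> exists2 r, r != 0 & v = vertex0 r.
Proof.
have [//|[r nr ->]] := vertexP v.
by rewrite -vertex1_0 adj_vertex11 ?invertible0.
Qed.

Lemma leaf_vertex0 r v : invertible r -> adj (vertex0 r) v -> v = hub.
Proof.
move=> ur; have r0 : r != 0 by apply: contraTneq ur => ->; exact: invertible0.
have [[s s0 ->]|[s ns ->]] := vertexP v.
  rewrite adj_vertex00 // => /andP[_ /eqP/(invertible_mul_eq0 ur)/eqP].
  by rewrite (negPf s0).
by rewrite adj_vertex01 // => /eqP/(invertible_mul_eq0 ur)->; apply: vertex1_0.
Qed.

Lemma psi_g_le2 : (psi_g G <= 2)%N.
Proof.
by apply: (@leaf_psi_g _ hub (vertex0 1)) => v; apply/leaf_vertex0/invertible1.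
Qed.

(** The neighbours of the hub are the [#|R| - 1] vertices (0, r). The set [A] counts those in [S]
    and [B] the others; the alliance condition at the hub reads [#|B| <= #|A| + 1]. *)
Lemma hub_neighbors_le (S : {set G}) : defensive_alliance S -> hub \in S ->
  (#|R| <= 2 * #|[set r : R | (r != 0%R) && (vertex0 r \in S)]| + 2)%N.
Proof.
case/andP=> _ /forall_inP/[apply].
set A := [set r : R | (r != 0) && (vertex0 r \in S)].
set B := [set r : R | (r != 0) && (vertex0 r \notin S)].
have /subset_leq_card : S :&: nbhd hub \subset vertex0 @: A.
  apply/subsetP=> v; rewrite !inE => /andP[vS /adj_hub[r r0 ev]].
  by apply/imsetP; exists r; rewrite // inE r0 -ev.
have /subset_leq_card : vertex0 @: B \subset ~: S :&: nbhd hub.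
  apply/subsetP=> _ /imsetP[r + ->]; rewrite !inE => /andP[r0 rS].
  by rewrite rS adj_sym; exact: adj_vertex0_hub.
rewrite card_in_imset; last first.
  by apply: sub_in2 vertex0_inj => r; rewrite !inE => /andP[].
have := leq_imset_card vertex0 A.
have : (#|R| <= #|A| + #|B| + 1)%N.
  have -> : #|R| = #|(A :|: B) :|: [set 0]|.
    rewrite -cardsT; apply: eq_card => r; rewrite !inE.
    by case: eqVneq => //= _; rewrite orbF orbN.
  by rewrite (leq_trans (leq_card_setU _ _)) // cards1 leq_add2r leq_card_setU.
rewrite /deg_in; lia.
Qed.

(** * A block containing the hub and a block disjoint from it *)

Section HubBlock.
Hypothesis R_local : local_ring R.
Variables S T : {set G}.
Hypothesis gS : global_defensive_alliance S.
Hypothesis gT : global_defensive_alliance T.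
Hypotheses (dST : [disjoint S & T]) (hubS : hub \in S).

Let SnT v : v \in S -> v \notin T.
Proof. by move=> vS; rewrite (disjointFr dST vS). Qed.

Let N := [set r : R | ~~ invertible r].
Let A := [set r : R | (r != 0) && (vertex0 r \in S)].

(** The leaves (0, u) with u a unit lie in [T], so [A] contains no unit. Equality follows by
    counting: [2 * #|N| <= #|R| <= 2 * #|A| + 2]. *)
Lemma hub_neighborsE : A = N :\ 0.
Proof.
apply/eqP; rewrite eqEcard; apply/andP; split; last first.
  have N0 : 0 \in N by rewrite inE invertible0.
  have := cardsD_zero N0.
  have := local_noninvertible_card R_local; rewrite -/N.
  by have /andP[_ /hub_neighbors_le/(_ hubS)] := gS; rewrite -/A; lia.
apply/subsetP=> r; rewrite !inE => /andP[-> rS] /=.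
apply: contraL rS => ur; have /andP[dT _] := gT.
have := dominating_leaf dT (fun v => @leaf_vertex0 r v ur) (SnT hubS).
by apply: contraL => /SnT.
Qed.

Let vertex0NT r : r != 0 -> ~~ invertible r -> vertex0 r \notin T.
Proof.
move=> r0 nr; apply: SnT.
have : r \in A by rewrite hub_neighborsE !inE r0.
by rewrite inE => /andP[].
Qed.

Lemma small_annihilator r : r != 0 -> ~~ invertible r ->
  exists b : R,
    [/\ b != 0, b * r = 0 & (#|[set y : R | (b * y == 0)%R]| <= 2)%N].
Proof.
move=> r0 nr.
have /andP[/andP[_ /forall_inP dT] /andP[_ /forall_inP aT]] := gT.
have := dT (vertex0 r); rewrite inE vertex0NT // => /(_ isT)/card_gt0P[w].
rewrite !inE => /andP[wT]; move: (wT).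
(* A neighbour of (0, r) in [T] cannot be some (0, b): then b would be a nonzero non-unit, which
   puts (0, b) in [S]. *)
have [[b b0 ->] + aw|[b nb ew wT' aw]] := vertexP w.
  have /andP[_ /eqP rb] : (r != b) && (r * b == 0) by rewrite -adj_vertex00.
  rewrite (negPf (vertex0NT b0 _)) //.
  by apply: zero_divisor_noninvertible r0 _; rewrite mulrC.
have rb : r * b == 0 by rewrite -adj_vertex01 // -ew.
have b0 : b != 0.
  by apply: contraL wT => /eqP eb; rewrite ew eb vertex1_0 SnT.
exists b; split=> //; first by rewrite mulrC; apply/eqP.
set ann := [set y | _].
have annN y : y \in ann -> ~~ invertible y.
  rewrite inE mulrC => /eqP; exact: zero_divisor_noninvertible b0.
(* Each neighbour of [w] = (1, b) is some (0, y) with y a nonzero non-unit, hence outside [T]. With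
   degree 0 in [T], the alliance condition leaves [w] at most one neighbour, so [ann] has at most
   one nonzero element. *)
have := aT w wT; have -> : deg_in T w = 0%N.
  apply: eq_card0 => z; rewrite !inE; apply/negP=> /andP[zT].
  have [[y y0 ez]|[y ny ez]] := vertexP z; rewrite ew ez; last first.
    by rewrite adj_vertex11.
  rewrite adj_sym adj_vertex01 // mulrC => yb.
  by move: zT; rewrite ez (negPf (vertex0NT y0 (annN y _))) // inE.
have /subset_leq_card : vertex0 @: (ann :\ 0) \subset ~: T :&: nbhd w.
  apply/subsetP=> _ /imsetP[y + ->]; rewrite in_setD1 => /andP[y0 yann].
  rewrite in_setI in_setC (vertex0NT y0 (annN y yann)) inE ew adj_sym.
  by rewrite (adj_vertex01 y0 nb) mulrC; move: yann; rewrite inE.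
rewrite card_in_imset; last first.
  by apply: sub_in2 vertex0_inj => y; rewrite !inE => /andP[].
have ann0 : 0 \in ann by rewrite inE mulr0.
by rewrite (cardsD_zero ann0) => le1 /(leq_trans le1).
Qed.

Lemma noninvertible_card_le2 r :
  r != 0 -> ~~ invertible r -> r * r = 0 /\ (#|N| <= 2)%N.
Proof.
move=> r0 nr.
(* The product [x * y] lies in the annihilator {0, y} of some [b]. If it were [y], the unit [1 - x]
   would kill [y]. *)
have mulN (x y : R) : ~~ invertible x -> ~~ invertible y -> x * y = 0.
  move=> nx ny; have [->|y0] := eqVneq y 0; first by rewrite mulr0.
  have [b [b0 yb annb]] := small_annihilator y0 ny.
  have annE : [set 0; y] = [set z | b * z == 0].
    apply/eqP; rewrite eqEcard subUset !sub1set !inE mulr0 yb eqxx /=.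
    by rewrite cards2 eq_sym y0.
  have : x * y \in [set 0; y] by rewrite annE inE mulrCA yb mulr0.
  case/set2P=> // xy; have u1x := local_invertible1B R_local nx.
  move/eqP: y0; case; apply: (invertible_mul_eq0 u1x).
  by rewrite mulrBl xy mul1r subrr.
have [b [b0 br annb]] := small_annihilator r0 nr.
split; first exact: mulN.
(* As [b] is itself a non-unit, all non-units lie in its annihilator. *)
rewrite (leq_trans _ annb) // subset_leq_card //; apply/subsetP=> x.
rewrite !inE => nx; rewrite mulN //.
exact: zero_divisor_noninvertible r0 br.
Qed.

End HubBlock.

Lemma gda_partitionable_order4 :
  local_ring R -> ~ is_field R -> gda_partitionable G -> order4_nilpotent R.
Proof.
move=> locR nfR /(gda_partitionable_blocks hub)[S [T [gS gT dST hS]]].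
have [r /andP[r0 nr]] : exists r : R, (r != 0) && ~~ invertible r.
  apply/existsP/contraT => /existsPn noN; case: nfR => x x0.
  have := noN x; rewrite x0 negbK => /existsP[y /eqP xy].
  by exists y.
have [rr N2] := noninvertible_card_le2 locR gS gT dST hS r0 nr.
split; last by exists r.
(* Now [N] has exactly two elements, so the hub gives [#|R| <= 2 * 1 + 2], while locality gives
   [2 * 2 <= #|R|]. *)
have /andP[_ /hub_neighbors_le/(_ hS)] := gS.
rewrite (hub_neighborsE locR gS gT dST hS).
have := local_noninvertible_card locR.
set N := [set r : R | ~~ invertible r] in N2 *.
have N0 : 0 \in N by rewrite inE invertible0.
have := cardsD_zero N0.
have : (0 < #|N :\ 0%R|)%N by apply/card_gt0P; exists r; rewrite !inE r0.
lia.
Qed.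

Lemma order4_gda_partitionable : order4_nilpotent R -> gda_partitionable G.
Proof.
move=> [R4 [m m0 mm]].
have nm : ~~ invertible m := zero_divisor_noninvertible m0 mm.
have m1 : 1 + m != 0 := nilpotent_add1_neq0 mm.
have um : invertible (1 + m).
  apply/existsP; exists (1 - m).
  by rewrite mulrDl mul1r mulrBr mulr1 mm subr0 subrK.
have n0 := invertible0 R.
(* The graph is a tree on five vertices: the hub is joined to (0, 1), (0, m) and (0, 1 + m), and (0,
   m) is also joined to (1, m). *)
pose S : {set G} := [set hub; vertex0 m].
have [hubS mS] : hub \in S /\ vertex0 m \in S by rewrite set21 set22.
have T_cases v : v \in ~: S ->
    [\/ v = vertex0 1, v = vertex0 (1 + m) | v = vertex1 m].
  rewrite in_setC; have [[x x0 ->]|[x nx ->]] := vertexP v.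
    have [ex|->|->|->] := order4_enum x R4 m0 mm.
    - by rewrite ex eqxx in x0.
    - by move=> _; constructor 1.
    - by rewrite mS.
    - by move=> _; constructor 2.
  have [->|ex|->|ex] := order4_enum x R4 m0 mm.
  - by rewrite vertex1_0 hubS.
  - by rewrite ex invertible1 in nx.
  - by move=> _; constructor 3.
  - by rewrite ex um in nx.
have leaf_notin u : invertible u -> vertex0 u \notin S.
  move=> uu.
  have u0 : u != 0 by apply: contraTneq uu => ->.
  rewrite !inE -!(inj_eq pair_of_inj) pair_of_vertex0 // pair_of_vertex0 //.
  rewrite !xpair_eqE negb_or negb_and u0 eqxx.
  by apply: contraTneq uu => ->.
have m_notin : vertex1 m \notin S.
  rewrite !inE -!(inj_eq pair_of_inj) pair_of_vertex0 // pair_of_vertex1 //.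
  by rewrite !xpair_eqE negb_or negb_and m0 orbT negb_and oner_eq0.
have hub_adj u : u != 0 -> adj hub (vertex0 u).
  by move=> u0; rewrite adj_sym adj_vertex0_hub.
have m_adj : adj (vertex0 m) (vertex1 m) by rewrite adj_vertex01 // mm.
apply: (@gda_bipartition_partitionable _ S); do 2?[apply/andP; split].
- by apply/set0Pn; exists hub.
- apply/forall_inP=> v /T_cases[]->.
  + by apply: (deg_in_gt0 hubS); rewrite adj_vertex0_hub ?oner_eq0.
  + by apply: (deg_in_gt0 hubS); rewrite adj_vertex0_hub.
  + by apply: (deg_in_gt0 mS); rewrite adj_sym.
- by apply/set0Pn; exists hub.
- apply/forall_inP=> v /set2P[]->.
    (* The hub has one neighbour in [S] and at most two outside, so the slack of 1 in the alliance
       condition is what makes it hold. *)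
    have := deg_in_gt0 mS (hub_adj m m0).
    suff : (deg_in (~: S) hub <= #|[set vertex0 1%R; vertex0 (1 + m)%R]|)%N.
      by rewrite cards2; lia.
    apply: deg_in_le => w /T_cases[]->; rewrite ?set21 ?set22 //.
    by rewrite -vertex1_0 adj_vertex11.
  suff : (deg_in (~: S) (vertex0 m) <= #|[set vertex1 m]|)%N.
    by rewrite cards1; lia.
  apply: deg_in_le => w /T_cases[]->; last by rewrite set11.
  + by rewrite adj_vertex00 ?oner_eq0 // mulr1 (negPf m0) andbF.
  + by rewrite adj_vertex00 // mulrDr mulr1 mm addr0 (negPf m0) andbF.
- by apply/set0Pn; exists (vertex1 m); rewrite in_setC.
- rewrite setCK; apply/forall_inP=> v /set2P[]->.
    apply: (@deg_in_gt0 _ _ _ (vertex0 1)); last by rewrite hub_adj ?oner_eq0.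
    by rewrite in_setC leaf_notin ?invertible1.
  by apply: (@deg_in_gt0 _ _ _ (vertex1 m)); rewrite ?in_setC.
- by apply/set0Pn; exists (vertex1 m); rewrite in_setC.
apply/forall_inP=> v vT; rewrite setCK.
(* Each vertex of the complement has at most one neighbour in [S], which the slack of 1 alone
   absorbs. *)
suff : exists x, {in S, forall w, adj v w -> w \in [set x]}.
  by case=> x /deg_in_le; rewrite cards1; lia.
move: vT => /T_cases[]->.
- by exists hub => w _ /leaf_vertex0 ->; rewrite ?set11 ?invertible1.
- by exists hub => w _ /leaf_vertex0 ->; rewrite ?set11.
exists (vertex0 m) => w /set2P[]->; last by rewrite set11.
by rewrite -vertex1_0 adj_vertex11.
Qed.

End ZeroDivisorGraphZ2.

Theorem theorem3p8 (R : finComNzRingType)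
    (R_local : local_ring R) (R_not_field : ~ is_field R) :
  (gda_partitionable (zero_divisor_graph ('Z_2 * R)%type) <->
     (ring_isomorphic R 'Z_4 \/
      ring_isomorphic R {poly %/ ('X^2 : {poly 'Z_2})})) /\
  (gda_partitionable (zero_divisor_graph ('Z_2 * R)%type) ->
     psi_g (zero_divisor_graph ('Z_2 * R)%type) = 2%N).
Proof.
split; last by move=> psi2; apply/eqP; rewrite eqn_leq psi_g_le2.
split=> [/(gda_partitionable_order4 R_local R_not_field)|].
  exact: order4_nilpotent_isomorphic.
by move=> /isomorphic_order4_nilpotent/order4_gda_partitionable.
Qed.
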